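(* Let $h$ be a probability density on $\mathbb{S}^1$ and let $T_h:\mathbb{T}^n\to\mathbb{T}^n$ be the Lloyd map associated with $h$. For $\alpha\in\mathbb{S}^1$ let $R_\alpha:\mathbb{S}^1\to\mathbb{S}^1$ be the rotation $R_\alpha(\theta)=\theta+\alpha \pmod{2\pi}$, acting on $\mathbb{T}^n$ componentwise, and define the rotated density $h_\alpha(\theta):=h(\theta-\alpha)$. Then $$T_{h_\alpha}(R_\alpha Q)=R_\alpha T_h(Q)\qquad\text{for all } Q\in\mathbb{T}^n \text{ and all } \alpha\in\mathbb{S}^1 .$$
   Context: $\mathbb{S}^1$ is identified with $\mathbb{R}/2\pi\mathbb{Z}$ (angles in $[0,2\pi)$), with geodesic distance $d_G(\theta,\phi)=\min(|\theta-\phi|,2\pi-|\theta-\phi|)$, and $\mathbb{T}^n=(\mathbb{R}/2\pi\mathbb{Z})^n$, $n\ge 2$. Densities are with respect to the angular coordinate, with $h\in L^1(\mathbb{S}^1)$ and $h(\theta)>0$. For a configuration $Q=(q_1,\dots,q_n)\in\mathbb{T}^n$ the Voronoi cell of $q_j$ is $$R_j(Q)=\{\theta\in\mathbb{S}^1 : d_G(\theta,q_j)\le d_G(\theta,q_k)\text{ for all }k\ne j\}.$$ Standing assumption: configurations are such that every Voronoi cell is an arc of length strictly less than $\pi$. The Lloyd map $T_h$ sends each codepoint to the centroid of its Voronoi cell, given by the circular mean $$[T_h(Q)]_j=\arg\left(\int_{R_j(Q)}e^{i\theta}h(\theta)\,d\theta\right)\pmod{2\pi}.$$ *)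

(* Defs.v *)
From HB Require Import structures.
From mathcomp Require Import all_boot all_order all_algebra.
From mathcomp Require Import all_classical all_reals all_analysis.
From mathcomp.real_closed Require Import complex.

Set Implicit Arguments.
Unset Strict Implicit.
Unset Printing Implicit Defensive.

Import Order.TTheory GRing.Theory Num.Theory.
Import numFieldNormedType.Exports.

Local Open Scope classical_set_scope.
Local Open Scope ring_scope.
Local Open Scope complex_scope.

(* S^1 = R/2piZ, each class being given by its representative in [0, 2pi) *)
Record circle (R : realType) := Circle {
  angle : R;
  angle_range : 0 <= angle < 2 * pi
}.

HB.instance Definition _ (R : realType) := [isSub for @angle R].
HB.instance Definition _ (R : realType) := [Choice of circle R by <:].

Definition reduce_angle (R : realType) (x : R) : R :=
  x - 2 * pi * (Num.floor (x / (2 * pi)))%:~R.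

Lemma reduce_angle_range (R : realType) (x : R) :
  0 <= reduce_angle x < 2 * pi.
Proof.
have pi20 : 0 < 2 * pi :> R by rewrite mulr_gt0 // pi_gt0.
rewrite /reduce_angle subr_ge0 ltrBlDr mulrC -ler_pdivlMr // floor_le /=.
rewrite -[X in _ < X + _]mul1r -mulrDl -ltr_pdivrMr // addrC.
by rewrite -intrD1 floorD1_gt.
Qed.

(* the canonical projection R -> R/2piZ *)
Definition to_circle (R : realType) (x : R) : circle R :=
  Circle (reduce_angle_range x).

Definition geodesic_dist (R : realType) (t u : circle R) : R :=
  Num.min `|angle t - angle u| (2 * pi - `|angle t - angle u|).

Definition torus (R : realType) (n : nat) := {ffun 'I_n -> circle R}.

Definition rotation (R : realType) (a t : circle R) : circle R :=
  to_circle (angle t + angle a).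

Definition torus_rotation (R : realType) (n : nat) (a : circle R)
    (Q : torus R n) : torus R n :=
  [ffun j => rotation a (Q j)].

Definition rotated_density (R : realType) (a : circle R) (h : circle R -> R) :
    circle R -> R :=
  fun t => h (to_circle (angle t - angle a)).

(* integral over A of f with respect to the angular coordinate in [0, 2pi) *)
Definition circle_integral (R : realType) (A : set (circle R))
    (f : circle R -> R) : R :=
  \int[lebesgue_measure]_(x in (@angle R) @` A) f (to_circle x).

Definition probability_density (R : realType) (h : circle R -> R) : Prop :=
  [/\ lebesgue_measure.-integrable `[0, 2 * pi[ (fun x : R => (h (to_circle x))%:E),
      forall t, 0 < h t
    & circle_integral setT h = 1].

Definition voronoi_cell (R : realType) (n : nat) (Q : torus R n) (j : 'I_n) :
    set (circle R) :=
  [set t | forall k, k != j ->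
             geodesic_dist t (Q j) <= geodesic_dist t (Q k)].

Definition short_arc (R : realType) (A : set (circle R)) : Prop :=
  exists (a : circle R) (l : R),
    0 <= l < pi /\ A = [set to_circle (angle a + x) | x in `[0, l]].

Definition cexpi (R : realType) (t : circle R) : R[i] :=
  cos (angle t) +i* sin (angle t).

(* The argument of z <> 0; an unspecified angle when z = 0. *)
Definition carg (R : realType) (z : R[i]) : circle R :=
  xget (to_circle 0) [set t | z = `|z| * cexpi t].

Definition circle_integralC (R : realType) (A : set (circle R))
    (f : circle R -> R[i]) : R[i] :=
  circle_integral A (fun t => complex.Re (f t)) +i*
  circle_integral A (fun t => complex.Im (f t)).

Definition lloyd (R : realType) (n : nat) (h : circle R -> R) (Q : torus R n) :
    torus R n :=
  [ffun j => carg (circle_integralC (voronoi_cell Q j)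
                     (fun t => cexpi t * (h t)%:C))].

(* Main.v *)
Require Import Defs.
From mathcomp Require Import all_boot all_order all_algebra.
From mathcomp Require Import all_classical all_reals all_analysis.
From mathcomp.real_closed Require Import complex.
From mathcomp Require Import measurable_realfun.
From mathcomp Require Import ring lra.

(** The Voronoi cells, the density and the centroid integral are all carried
    along by a rotation, and the circular mean turns multiplication by a phase
    into a rotation.

    Write alpha for the angle of a. Geodesic distance on the circle is
    arccos (cos (t - u)), hence depends only on the difference of angles, and
    the cell of the rotated configuration is the preimage of the original cell
    under the inverse rotation ([voronoi_cell_torus_rotation]). The integral
    over the circle is invariant under rotation ([circle_integral_unrotate]),
    which follows from translation invariance of Lebesgue measure once
    [0, 2 pi) is cut at the point where the rotation wraps around. Pulling the
    integral of e^(i t) h(t - alpha) over the rotated cell back to the original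
    one therefore produces the factor e^(i alpha) ([circle_integralC_rotate]).

    Taking arguments commutes with this factor only for a nonzero complex
    number ([carg_cexpiM]), so the centroid integral must be shown not to
    vanish. This is where the short cells enter: all points of an arc of length
    less than pi are at distance less than pi / 2 from its midpoint m, so
    cos (t - m) h(t) is positive on the cell, and its integral, which is the
    component of the centroid in the direction m, is positive as soon as the
    cell has positive measure ([circle_integralC_arc_neq0]). The latter always
    holds, because a cell contains all points close to its own codepoint
    ([voronoi_cell_right_nbhs]); other codepoints at the same place impose no
    condition, and the others are at a positive distance. *)

Set Implicit Arguments.
Unset Strict Implicit.
Unset Printing Implicit Defensive.

Import Order.TTheory GRing.Theory Num.Theory.
Import numFieldNormedType.Exports.

Local Open Scope classical_set_scope.
Local Open Scope ring_scope.
Local Open Scope complex_scope.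

(** * Angles, periodicity and geodesic distance *)

Section circle_coordinates.
Variable R : realType.
Implicit Types (x y : R) (t u : circle R).

Lemma angle_inj : injective (@angle R).
Proof. exact: val_inj. Qed.

Lemma twopi_gt0 : 0 < 2 * pi :> R.
Proof. by rewrite mulr_gt0 // pi_gt0. Qed.

Lemma cosD2piz x (k : int) : cos (x + 2 * pi * k%:~R) = cos x.
Proof.
case: k => n.
  have -> : x + 2 * pi * (Posz n)%:~R = x + (pi *+ 2) *+ n :> R.
    by rewrite -[(Posz n)%:~R]/(n%:R) mulr_natr -(mulr_natl pi 2).
  exact: (periodicn (@cosD2pi R)).
rewrite -(periodicn (@cosD2pi R) n.+1); congr cos.
rewrite NegzE mulrNz -[(Posz n.+1)%:~R]/(n.+1%:R) -mulr_natr.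
by rewrite -(mulr_natl pi 2); ring.
Qed.

Lemma sinD2piz x (k : int) : sin (x + 2 * pi * k%:~R) = sin x.
Proof. by rewrite -!cosBpihalf addrAC cosD2piz. Qed.

Lemma to_circleP x : exists k : int, angle (to_circle x) = x + 2 * pi * k%:~R.
Proof.
exists (- Num.floor (x / (2 * pi))).
by rewrite /to_circle /= /reduce_angle mulrNz mulrN.
Qed.

Lemma angle_to_circle x : 0 <= x < 2 * pi -> angle (to_circle x) = x.
Proof.
move=> /andP[x0 x2]; rewrite /= /reduce_angle.
rewrite (_ : Num.floor _ = 0) ?mulr0 ?subr0 //.
by apply: floor_def; rewrite divr_ge0 ?(ltW twopi_gt0) //= ltr_pdivrMr
  ?twopi_gt0 // mul1r.
Qed.

Lemma angleK : cancel (@angle R) (@to_circle R).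
Proof. by move=> t; apply: angle_inj; rewrite angle_to_circle ?angle_range. Qed.

Lemma cos_to_circle x y : cos (angle (to_circle x) + y) = cos (x + y).
Proof. by have [k ->] := to_circleP x; rewrite addrAC cosD2piz. Qed.

Lemma sin_to_circle x y : sin (angle (to_circle x) + y) = sin (x + y).
Proof. by have [k ->] := to_circleP x; rewrite addrAC sinD2piz. Qed.

Lemma cos_lt1 x : x != 0 -> `|x| < 2 * pi -> cos x < 1.
Proof.
move=> x0 x2; rewrite -cos_norm (_ : `|x| = (`|x| / 2) *+ 2); last first.
  by rewrite -mulr_natr divfK.
rewrite cos_mulr2n.
have sx : 0 < sin (`|x| / 2).
  apply: sin_gt0_pi; rewrite divr_gt0 ?normr_gt0 //=.
  by rewrite ltr_pdivrMr // mulrC.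
have := cos2Dsin2 (`|x| / 2); have := exprn_gt0 2 sx.
by rewrite -mulr_natr; lra.
Qed.

Lemma norm_angleB t u : `|angle t - angle u| < 2 * pi.
Proof.
have /andP[t0 t2] := angle_range t; have /andP[u0 u2] := angle_range u.
by rewrite ltr_norml; apply/andP; split; lra.
Qed.

(** The working criterion for equality of points of the circle: it reduces
    identities modulo 2 pi to the periodicity of the cosine. *)
Lemma cos_angleB_eq1 t u : cos (angle t - angle u) = 1 -> t = u.
Proof.
move=> c1; apply: angle_inj; apply/eqP; rewrite -subr_eq0; apply/negP => /negP.
by move=> /cos_lt1 /(_ (norm_angleB t u)); rewrite c1 ltxx.
Qed.

(** On [0, pi] the arccosine inverts the cosine, and for a difference beyond pi
    the cosine is that of the complementary arc. The two branches of the
    minimum thus merge into one expression that is periodic in each angle. *)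
Lemma geodesic_dist_acos t u :
  geodesic_dist t u = acos (cos (angle t - angle u)).
Proof.
rewrite /geodesic_dist; set d := `|_|.
have d0 : 0 <= d := normr_ge0 _.
have d2 : d < 2 * pi := norm_angleB t u.
rewrite -cos_norm -/d; have [dpi|dpi] := leP d pi.
  rewrite cosK ?in_itv /= ?d0 // min_l //; lra.
have -> : cos d = cos (2 * pi - d).
  by rewrite -[RHS]cosN opprB; have := cosD2piz d (-1); rewrite mulrN1.
by rewrite cosK ?in_itv /= ?min_r //; lra.
Qed.

(** Comparing cosines instead of distances makes rotation invariance,
    continuity and measurability of Voronoi cells immediate. *)
Lemma geodesic_dist_le t u v :
  (geodesic_dist t u <= geodesic_dist t v) =
  (cos (angle t - angle v) <= cos (angle t - angle u)).
Proof.
have dE w : geodesic_dist t w = acos (cos (angle t - angle w)).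
  exact: geodesic_dist_acos.
have cosr y : -1 <= cos y <= 1 by rewrite cos_geN1 cos_le1.
have homo : {in `[0, pi] &, forall x y, (cos x <= cos y) = (y <= x)}.
  by move=> x y x0 y0; rewrite !leNgt ltr_cos.
have in0pi y : acos (cos y) \in `[0, pi].
  by rewrite in_itv /= acos_ge0 ?acos_lepi.
rewrite !dE -homo //; by rewrite !acosK ?in_itv /=.
Qed.

Lemma to_circleD2piz x (k : int) : to_circle (x + 2 * pi * k%:~R) = to_circle x.
Proof.
apply: cos_angleB_eq1; have [m ->] := to_circleP x.
rewrite cos_to_circle opprD addrACA subrr add0r -mulrBr -intrB.
by rewrite -[X in cos X]add0r cosD2piz cos0.
Qed.

(** The inverse of the rotation by [a], in the form in which it occurs inside
    a rotated density. *)
Definition unrotate (a t : circle R) : circle R :=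
  to_circle (angle t - angle a).

Lemma unrotate_to_circle a x :
  unrotate a (to_circle x) = to_circle (x - angle a).
Proof.
rewrite /unrotate; have [k ->] := to_circleP x.
by rewrite addrAC to_circleD2piz.
Qed.

End circle_coordinates.

(** * Rotation invariance of integrals over the circle *)

Section rotation_invariance.
Variable R : realType.
Local Notation mu := (@lebesgue_measure R).
Implicit Types (c x y : R) (t u a : circle R).

Lemma measurable_shift c : measurable_fun [set: measurableTypeR R]
  (fun x : measurableTypeR R => (x + c : measurableTypeR R)).
Proof.
apply: continuous_measurable_fun => x.
by apply: cvgD; [exact: cvg_id|exact: cvg_cst].
Qed.

Lemma measurable_fun_shift d (T : measurableType d) c (D : set R)
    (f : R -> T) :
  measurable D -> measurable_fun D f ->
  measurable_fun [set x | D (x + c)] (fun x => f (x + c)).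
Proof.
move=> mD mf; apply: (measurable_comp mD) => //.
- by move=> _ [x Dx <-].
- exact: measurable_funS (measurable_shift c).
Qed.

(** Lebesgue measure is determined by its values on half-open intervals, whose
    length a translation preserves. *)
Lemma lebesgue_measure_shift c (A : set R) : measurable A ->
  pushforward mu (fun x : R => x + c : R) A = mu A.
Proof.
move=> mA.
have mphi := measurable_shift c.
have shift_unique := @lebesgue_measure_unique R
  (measure_function_pushforward__canonical__measure_function_Measure mu mphi).
apply/esym; apply: shift_unique => // _ [[x y] _ <-].
rewrite /= /pushforward /=.
rewrite (_ : _ @^-1` _ = `]x - c, y - c]%classic); last first.
  by apply/seteqP; split=> z /=; rewrite !in_itv /= ltrBlDr lerBrDr.
rewrite !lebesgue_measure_itv /= !lte_fin ltrD2r; case: ifPn => // _.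
by rewrite -!EFinB; congr EFin; ring.
Qed.

Lemma ge0_integral_shift c (D : set R) (f : R -> \bar R) :
  measurable D -> measurable_fun D f -> (forall x, D x -> 0 <= f x)%E ->
  (\int[mu]_(x in D) f x =
   \int[mu]_(x in [set x | D (x + c)%R]) f (x + c)%R)%E.
Proof.
move=> mD mf f0.
have mphi := measurable_shift c.
have := @ge0_integral_pushforward _ _ _ _ R _ mphi mu D f mD mf.
move=> <-; last by move=> x /set_mem; exact: f0.
apply: eq_measure_integral => A mA _.
exact/esym/lebesgue_measure_shift.
Qed.

Local Notation period := `[0, 2 * pi[%classic.

(** As x runs through [0, 2 pi), x - alpha runs through [0, 2 pi - alpha) when
    alpha <= x, and wraps around to [2 pi - alpha, 2 pi) when x < alpha; on each
    piece the change of variable is a translation. *)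
Lemma ge0_integral_unrotate a (f : circle R -> \bar R) :
  measurable_fun period (f \o @to_circle R) -> (forall t, 0 <= f t)%E ->
  (\int[mu]_(x in period) f (unrotate a (to_circle x)) =
   \int[mu]_(x in period) f (to_circle x))%E.
Proof.
move=> mf f0; have /andP[a0 a2] := angle_range a.
set F := f \o @to_circle R in mf *.
have splitI c : 0 <= c -> c <= 2 * pi ->
    period = `[0, c[%classic `|` `[c, 2 * pi[%classic :> set R.
  by move=> c0 c2; rewrite -itv_bndbnd_setU // bnd_simp.
have disj c : [disjoint `[0, c[%classic & `[c, 2 * pi[%classic :> set R].
  rewrite disj_set2E; apply/eqP; apply/seteqP; split => x //=.
  by rewrite !in_itv /= => -[/andP[_ xc] /andP[]]; rewrite leNgt xc.
have mlow : measurable_fun `[0, 2 * pi - angle a[ F.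
  apply: measurable_funS mf => // x /=; rewrite !in_itv /=.
  by move=> /andP[-> ?] /=; lra.
have mhigh : measurable_fun `[(2 * pi - angle a), 2 * pi[ F.
  apply: measurable_funS mf => // x /=; rewrite !in_itv /=.
  by move=> /andP[? ->]; rewrite andbT; lra.
have itvlow : [set x | `[0, 2 * pi - angle a[%classic (x - angle a)] =
    `[angle a, 2 * pi[%classic.
  by apply/seteqP; split => x /=; rewrite !in_itv /= subr_ge0 ltrD2r.
have itvhigh : [set x | `[(2 * pi - angle a), 2 * pi[%classic
    (x + (2 * pi - angle a))] = `[0, angle a[%classic.
  by apply/seteqP; split => x /=; rewrite !in_itv /= => /andP[? ?];
    apply/andP; split; lra.
have Elow x : f (unrotate a (to_circle x)) = F (x - angle a).
  by rewrite unrotate_to_circle.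
have Ehigh x : f (unrotate a (to_circle x)) = F (x + (2 * pi - angle a)).
  rewrite Elow /F /= -(to_circleD2piz (x - angle a) 1) mulr1.
  congr (f (to_circle _)).
  by rewrite addrAC addrA.
have := measurable_fun_shift (c := - angle a) (measurable_itv _) mlow.
rewrite itvlow => mlow'.
have := measurable_fun_shift (c := 2 * pi - angle a) (measurable_itv _) mhigh.
rewrite itvhigh => mhigh'.
have -> : (\int[mu]_(x in period) f (unrotate a (to_circle x)) =
    \int[mu]_(x in `[0%R, angle a[) F (x + (2 * pi - angle a))%R +
    \int[mu]_(x in `[angle a, (2 * pi)%R[) F (x - angle a)%R)%E.
  rewrite (splitI _ a0 (ltW a2)) ge0_integral_setU //.
  - by congr (_ + _)%E; apply: eq_integral => x _.
  - apply/measurable_funU => //; split.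
      rewrite (_ : (fun _ => _) = fun x => F (x + (2 * pi - angle a))) //.
      by apply/funext => x; rewrite Ehigh.
    rewrite (_ : (fun _ => _) = fun x => F (x - angle a)) //.
    by apply/funext => x; rewrite Elow.
have -> : (\int[mu]_(x in period) f (to_circle x) =
    \int[mu]_(x in `[0%R, (2 * pi - angle a)%R[) F x +
    \int[mu]_(x in `[(2 * pi - angle a)%R, (2 * pi)%R[) F x)%E.
  rewrite (splitI (2 * pi - angle a)); [|lra|lra].
  by rewrite ge0_integral_setU //; exact/measurable_funU.
have := ge0_integral_shift (- angle a) (measurable_itv _) mlow
  (fun x _ => f0 _).
rewrite itvlow => ->.
have := ge0_integral_shift (2 * pi - angle a) (measurable_itv _) mhigh
  (fun x _ => f0 _).
by rewrite itvhigh => ->; rewrite addeC.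
Qed.

Lemma image_angle (A : set (circle R)) :
  (@angle R) @` A = period `&` (@to_circle R @^-1` A).
Proof.
apply/seteqP; split=> [_ [t At <-]|x [/= x02 Ax]].
  by rewrite /= in_itv /= angle_range angleK.
by exists (to_circle x) => //; rewrite angle_to_circle // -[_ <= _ < _]in_itv.
Qed.

(** Absorbing the domain into the integrand makes the integral run over a full
    period, where rotation invariance applies. *)
Lemma circle_integral_restrict (A : set (circle R)) (f : circle R -> R) :
  circle_integral A f =
  fine (\int[mu]_(x in period) ((f \_ A) (to_circle x))%:E)%E.
Proof.
rewrite /circle_integral image_angle Rintegral_mkcondr /Rintegral.
by congr fine; apply: eq_integral => x _; rewrite /patch.
Qed.

(** By definition the integral is the difference of the integrals of the
    positive and negative parts, and both are invariant. *)
Lemma integral_unrotate a (g : circle R -> \bar R) :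
  measurable_fun period (g \o @to_circle R) ->
  (\int[mu]_(x in period) g (unrotate a (to_circle x)) =
   \int[mu]_(x in period) g (to_circle x))%E.
Proof.
move=> mg.
have gpos := @ge0_integral_unrotate a g^\+%E.
have gneg := @ge0_integral_unrotate a g^\-%E.
rewrite (integralE mu _ (g \o (unrotate a \o @to_circle R))).
rewrite (integralE mu _ (g \o @to_circle R)).
rewrite (funepos_comp g (@to_circle R)) (funeneg_comp g (@to_circle R)).
rewrite (funepos_comp g (unrotate a \o @to_circle R)).
rewrite (funeneg_comp g (unrotate a \o @to_circle R)).
congr (_ - _)%E.
  apply: gpos => [|t]; last exact: funepos_ge0.
  by rewrite -funepos_comp; exact: measurable_funepos.
apply: gneg => [|t]; last exact: funeneg_ge0.
by rewrite -funeneg_comp; exact: measurable_funeneg.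
Qed.

Lemma circle_integral_unrotate a (A : set (circle R)) (f : circle R -> R) :
  measurable_fun period ((f \_ A) \o @to_circle R) ->
  circle_integral (unrotate a @^-1` A) (f \o unrotate a) = circle_integral A f.
Proof.
move=> mf; rewrite !circle_integral_restrict; congr fine.
have mg : measurable_fun period ((EFin \o (f \_ A)) \o @to_circle R).
  exact/measurable_EFinP.
rewrite -[RHS](integral_unrotate a mg).
by apply: eq_integral => x _; rewrite /patch.
Qed.

End rotation_invariance.

(** * Voronoi cells *)

Section voronoi.
Variables (R : realType) (n : nat).
Implicit Types (Q : torus R n) (j k : 'I_n) (a : circle R).

Lemma voronoi_cell_torus_rotation a Q j :
  voronoi_cell (torus_rotation a Q) j = unrotate a @^-1` voronoi_cell Q j.
Proof.
have cosE t k : cos (angle t - angle (torus_rotation a Q k)) =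
    cos (angle (unrotate a t) - angle (Q k)).
  rewrite ffunE cos_to_circle -cosN opprB cos_to_circle -cosN.
  by congr cos; ring.
by apply/seteqP; split=> t /= ct k kj; have := ct k kj;
  rewrite !geodesic_dist_le !cosE.
Qed.

Lemma voronoi_cell_to_circle Q j (x : R) :
  voronoi_cell Q j (to_circle x) <->
  forall k, k != j -> cos (x - angle (Q k)) <= cos (x - angle (Q j)).
Proof.
by split=> cx k kj; have := cx k kj; rewrite geodesic_dist_le !cos_to_circle.
Qed.

Lemma continuous_cosD (b : R) : continuous (fun x : R => cos (x + b)).
Proof.
move=> x; apply: (@continuous_comp _ _ _ (fun x : R => x + b) (@cos R)).
  by apply: cvgD; [exact: cvg_id|exact: cvg_cst].
exact: continuous_cos.
Qed.

(** A cell is cut out by finitely many weak inequalities between continuous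
    functions of the angle. *)
Lemma measurable_voronoi_cell Q j :
  measurable ((@to_circle R @^-1` voronoi_cell Q j) : set R).
Proof.
rewrite (_ : _ @^-1` _ = \bigcap_(k in [set k | k != j])
    [set x : R | cos (x - angle (Q k)) <= cos (x - angle (Q j))]); last first.
  by apply/seteqP; split=> x /voronoi_cell_to_circle.
apply: fin_bigcap_measurable => [|k _]; first exact: finite_finset.
rewrite -[X in measurable X]setTI.
have mcos i := continuous_measurable_fun (@continuous_cosD (- angle (Q i))).
exact: (measurable_fun_ler (mcos k) (mcos j)).
Qed.

(** At its own codepoint, each inequality that defines the cell is either an
    identity (coinciding codepoints) or strict, hence persists nearby. Only the
    right side is retained: the angle of a codepoint is less than 2 pi but may
    be 0, so that a left neighbourhood could leave the fundamental domain. *)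
Lemma voronoi_cell_right_nbhs Q j : exists2 e : R, 0 < e &
  forall x, angle (Q j) <= x < angle (Q j) + e ->
    x < 2 * pi /\ voronoi_cell Q j (to_circle x).
Proof.
set q := angle (Q j).
have near_cos : \forall x \near q,
    forall k, cos (x - angle (Q k)) <= cos (x - q).
  apply: (@filter_forall _ _
    (fun k x => is_true (cos (x - angle (Q k)) <= cos (x - q)))
    (nbhs q) (nbhs_filter q)) => k.
  have [<-|Qkj] := eqVneq (Q j) (Q k).
    exact: nearW.
  have : 0 < cos (q - q) - cos (q - angle (Q k)).
    rewrite subrr cos0 subr_gt0 lt_neqAle cos_le1 andbT.
    by apply/eqP => /cos_angleB_eq1/eqP; exact/negP.
  have cvg_diff : cos (x - q) - cos (x - angle (Q k)) @[x --> q] -->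
      cos (q - q) - cos (q - angle (Q k)).
    by apply: cvgB; exact: continuous_cosD.
  move=> /(cvgr_gt _ cvg_diff); apply: filterS => x.
  by rewrite subr_gt0 => /ltW.
have near_2pi : \forall x \near q, x < 2 * pi.
  by apply: lt_nbhsl; have /andP[] := angle_range (Q j).
have [e /= e0 qe] := (nbhs_ballP q _).1 (filterI near_cos near_2pi).
exists e => // x /andP[qx xe].
have [|cosx x2pi] := qe x.
  by rewrite /ball /= distrC ger0_norm ?subr_ge0 // ltrBlDl.
by split => //; apply/voronoi_cell_to_circle.
Qed.

End voronoi.

(** * Arguments of complex numbers *)

Section argument.
Variable R : realType.
Implicit Types (a t u : circle R) (z : R[i]).

Lemma cexpi_rotation a t : cexpi (rotation a t) = cexpi a * cexpi t.
Proof.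
rewrite /cexpi -[angle (rotation _ _)]addr0 cos_to_circle sin_to_circle addr0.
rewrite cosD sinD; apply/eqP; rewrite eq_complex /=.
by apply/andP; split; apply/eqP; ring.
Qed.

Lemma norm_cexpi t : `|cexpi t| = 1.
Proof. by rewrite normc_def /= cos2Dsin2 sqrtr1. Qed.

Lemma cexpi_inj : injective (@cexpi R).
Proof.
move=> t u [ct st]; apply: cos_angleB_eq1.
by rewrite cosB ct st -!expr2 cos2Dsin2.
Qed.

(** The arccosine of the real part determines the angle up to sign, and the
    sign of the imaginary part settles it. *)
Lemma cexpi_surj z : `|z| = 1 -> exists t, z = cexpi t.
Proof.
case: z => x y; rewrite normc_def /= => -[xy1].
have xy : x ^+ 2 + y ^+ 2 = 1.
  by rewrite -[LHS]sqr_sqrtr ?addr_ge0 ?sqr_ge0 // xy1 expr1n.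
have x1 : -1 <= x <= 1.
  by have := sqr_ge0 y => y2; apply/andP; split; nra.
have cosx : cos (acos x) = x by rewrite acosK // in_itv.
have sinx : sin (acos x) = `|y|.
  by rewrite sin_acos // -xy addrAC subrr add0r sqrtr_sqr.
have to0 (b : R) : cexpi (to_circle b) = cos b +i* sin b.
  by rewrite /cexpi -[angle _]addr0 cos_to_circle sin_to_circle addr0.
have [y0|y0] := leP 0 y.
  by exists (to_circle (acos x)); rewrite to0 cosx sinx ger0_norm.
exists (to_circle (- acos x)).
by rewrite to0 cosN sinN cosx sinx ltr0_norm ?opprK.
Qed.

Lemma cargP z : z = `|z| * cexpi (carg z).
Proof.
rewrite /carg; apply: (@xgetPex _ _ [set t | z = `|z| * cexpi t]).
have [->|z0] := eqVneq z 0.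
  by exists (to_circle 0); rewrite /= normr0 mul0r.
have [|t zt] := @cexpi_surj (z / `|z|).
  by rewrite normrM normfV normr_id divff ?normr_eq0.
by exists t; rewrite /= -zt mulrC divfK ?normr_eq0.
Qed.

Lemma carg_unique z t : z != 0 -> z = `|z| * cexpi t -> carg z = t.
Proof.
move=> z0 zt; apply: cexpi_inj; apply: (mulfI (x := `|z|)).
  by rewrite normr_eq0.
by rewrite -cargP.
Qed.

(** Uniqueness of the polar form gives this for z nonzero. At z = 0 every point
    of the circle is an argument, and the arbitrary one that [carg] selects on
    both sides is not moved by the rotation. *)
Lemma carg_cexpiM a z : z != 0 -> carg (cexpi a * z) = rotation a (carg z).
Proof.
move=> z0; have ea0 : cexpi a != 0 by rewrite -normr_eq0 norm_cexpi oner_eq0.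
apply: carg_unique; first by rewrite mulf_neq0.
by rewrite normrM norm_cexpi mul1r cexpi_rotation {1}(cargP z) mulrCA.
Qed.

End argument.

(** * The centroid integral *)

Section centroid.
Variable R : realType.
Local Notation mu := (@lebesgue_measure R).
Local Notation period := `[0, 2 * pi[%classic.
Variable h : circle R -> R.
Hypothesis h_integrable : mu.-integrable period (fun x => (h (to_circle x))%:E).
Implicit Types (A : set (circle R)) (a t : circle R) (b x : R).

Lemma measurable_cosD_density b :
  measurable_fun period
    (fun x => cos (angle (to_circle x) + b) * h (to_circle x)).
Proof.
under [X in measurable_fun _ X]eq_fun do rewrite cos_to_circle.
apply: measurable_funM.
  exact: measurable_funS (continuous_measurable_fun (@continuous_cosD R b)).
by apply/measurable_EFinP; exact: (measurable_int _ h_integrable).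
Qed.

(** The density is integrable and the cosine is bounded by 1. The phase [b]
    covers the sine as well, as a cosine shifted by pi / 2. *)
Lemma integrable_cosD_density A b :
  measurable ((@to_circle R @^-1` A) : set R) ->
  mu.-integrable ((@angle R) @` A)
    (fun x => (cos (angle (to_circle x) + b) * h (to_circle x))%:E).
Proof.
move=> mA; rewrite image_angle.
have mperiod : measurable (period : set R) by [].
apply: (@integrableS _ _ _ mu period) => //; first exact: measurableI.
apply: le_integrable h_integrable => //.
  by apply/measurable_EFinP; exact: measurable_cosD_density.
by move=> x _; rewrite lee_fin normrM ler_piMl ?cos_max.
Qed.

Lemma circle_integral_cosD A b : measurable ((@to_circle R @^-1` A) : set R) ->
  circle_integral A (fun t => cos (angle t + b) * h t) =
  cos b * circle_integral A (fun t => cos (angle t) * h t) -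
  sin b * circle_integral A (fun t => sin (angle t) * h t).
Proof.
move=> mA; have mangle : measurable ((@angle R) @` A).
  by rewrite image_angle; exact: measurableI.
have cos_int : mu.-integrable ((@angle R) @` A)
    (EFin \o fun x => cos (angle (to_circle x)) * h (to_circle x)).
  have := integrable_cosD_density 0 mA.
  by under [X in integrable _ _ X]eq_fun do rewrite addr0.
have sin_int : mu.-integrable ((@angle R) @` A)
    (EFin \o fun x => sin (angle (to_circle x)) * h (to_circle x)).
  have := integrable_cosD_density (- (pi / 2)) mA.
  by under [X in integrable _ _ X]eq_fun do rewrite cosBpihalf.
rewrite /circle_integral -!RintegralZl // -RintegralB //.
- by apply: eq_Rintegral => x _; rewrite cosD; ring.
- exact: (integrableZl _ (cos b) cos_int).
- exact: (integrableZl _ (sin b) sin_int).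
Qed.

Lemma circle_integral_sinD A b : measurable ((@to_circle R @^-1` A) : set R) ->
  circle_integral A (fun t => sin (angle t + b) * h t) =
  sin b * circle_integral A (fun t => cos (angle t) * h t) +
  cos b * circle_integral A (fun t => sin (angle t) * h t).
Proof.
move=> mA; have := circle_integral_cosD (b - pi / 2) mA.
rewrite cosBpihalf sinBpihalf mulNr opprK => <-.
by congr circle_integral; apply/funext => t; rewrite addrA cosBpihalf.
Qed.

Lemma circle_integralC_cexpi A (g : circle R -> R) :
  circle_integralC A (fun t => cexpi t * (g t)%:C) =
  circle_integral A (fun t => cos (angle t) * g t) +i*
  circle_integral A (fun t => sin (angle t) * g t).
Proof.
congr (_ +i* _); congr circle_integral; apply/funext => t /=; ring.
Qed.

Lemma circle_integral_cosD_unrotate a A b :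
  measurable ((@to_circle R @^-1` A) : set R) ->
  circle_integral (unrotate a @^-1` A)
    (fun t => cos (angle t + b) * rotated_density a h t) =
  circle_integral A (fun t => cos (angle t + (angle a + b)) * h t).
Proof.
move=> mA; rewrite -[RHS](circle_integral_unrotate a); last first.
  have mf : measurable_fun (period `&` (@to_circle R @^-1` A))
      (fun x => cos (angle (to_circle x) + (angle a + b)) * h (to_circle x)).
    exact: measurable_funS (measurable_cosD_density _).
  exact: (measurable_restrict _ mA (measurable_itv _)).1 mf.
congr circle_integral; apply/funext => t.
by rewrite /= cos_to_circle addrA subrK.
Qed.

(** After the change of variable t = u + alpha, the factor e^(i t) becomes
    e^(i alpha) e^(i u). *)
Lemma circle_integralC_rotate a A :
  measurable ((@to_circle R @^-1` A) : set R) ->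
  circle_integralC (unrotate a @^-1` A)
    (fun t => cexpi t * (rotated_density a h t)%:C) =
  cexpi a * circle_integralC A (fun t => cexpi t * (h t)%:C).
Proof.
move=> mA; rewrite !circle_integralC_cexpi.
have -> : circle_integral (unrotate a @^-1` A)
    (fun t => cos (angle t) * rotated_density a h t) =
    circle_integral A (fun t => cos (angle t + angle a) * h t).
  have := circle_integral_cosD_unrotate a 0 mA; rewrite addr0 => <-.
  by congr circle_integral; apply/funext => t; rewrite addr0.
have -> : circle_integral (unrotate a @^-1` A)
    (fun t => sin (angle t) * rotated_density a h t) =
    circle_integral A (fun t => sin (angle t + angle a) * h t).
  have := circle_integral_cosD_unrotate a (- (pi / 2)) mA.
  under [X in circle_integral _ X = _]eq_fun do rewrite cosBpihalf.
  move=> ->; congr circle_integral; apply/funext => t.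
  by rewrite addrA cosBpihalf.
rewrite circle_integral_cosD // circle_integral_sinD //.
by apply/eqP; rewrite eq_complex /=; apply/andP; split; apply/eqP; ring.
Qed.

(** The component of the integral in the direction of the midpoint of the arc
    is the integral of a positive function. Were it zero, this function would
    vanish almost everywhere on [A], although [A] contains the interval
    [q, q + e), whose measure is e > 0. *)
Lemma circle_integralC_arc_neq0 A (q e : R) : (forall t, 0 < h t) ->
  measurable ((@to_circle R @^-1` A) : set R) -> short_arc A ->
  0 <= q -> 0 < e ->
  (forall x, q <= x < q + e -> x < 2 * pi /\ A (to_circle x)) ->
  circle_integralC A (fun t => cexpi t * (h t)%:C) != 0.
Proof.
move=> h0 mA [a [l [/andP[l0 lpi] Aarc]]] q0 e0 subA.
(* minus the angle of the midpoint of the arc *)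
pose b := - (angle a + l / 2).
have mangle : measurable ((@angle R) @` A).
  by rewrite image_angle; exact: measurableI.
have cos_gt0 t : A t -> 0 < cos (angle t + b) * h t.
  rewrite Aarc => -[x /=]; rewrite in_itv /= => /andP[x0 xl] <-.
  rewrite mulr_gt0 // cos_to_circle cos_gt0_pihalf // /b.
  by apply/andP; split; lra.
apply/eqP; rewrite circle_integralC_cexpi => -[C0 S0].
have := circle_integral_cosD b mA; rewrite C0 S0 !mulr0 subrr.
pose f x := (cos (angle (to_circle x) + b) * h (to_circle x))%:E.
have f_int : mu.-integrable ((@angle R) @` A) f := integrable_cosD_density b mA.
have f_gt0 x : ((@angle R) @` A) x -> (0 < f x)%E.
  by move=> [t At <-]; rewrite /f lte_fin angleK cos_gt0.
rewrite /circle_integral /Rintegral => int0.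
have {}int0 : (\int[mu]_(x in (@angle R) @` A) `|f x|)%E = 0%E.
  rewrite -[RHS]/(0%:E) -int0 fineK; last exact: integrable_fin_num.
  by apply: eq_integral => x /set_mem Ax; rewrite gee0_abs // ltW // f_gt0.
have [N [mN N0 subN]] :=
  (ae_eq_integral_abs mu mangle (measurable_int _ f_int)).1 int0.
have : (mu `[q, (q + e)%R[%classic <= mu N)%E.
  apply: le_measure; rewrite ?inE //.
  move=> x /=; rewrite in_itv /= => xq.
  apply: subN => /= fx0.
  have [x2 Ax] := subA x xq; have /andP[qx _] := xq.
  have angle_x : ((@angle R) @` A) x.
    by rewrite image_angle /= in_itv /= x2 (le_trans q0 qx).
  by have := f_gt0 _ angle_x; rewrite fx0 //= ltxx.
rewrite N0 lebesgue_measure_itv /= lte_fin ltrDl e0 -EFinB lee_fin.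
by rewrite addrAC subrr add0r leNgt e0.
Qed.

End centroid.

Theorem theorem3p1 (R : realType) (n : nat) (hn : (2 <= n)%N)
    (h : circle R -> R) (hh : probability_density h)
    (Q : torus R n) (hQ : forall j : 'I_n, short_arc (voronoi_cell Q j))
    (a : circle R) :
  lloyd (rotated_density a h) (torus_rotation a Q) =
  torus_rotation a (lloyd h Q).
Proof.
have [h_int h_gt0 _] := hh.
apply/ffunP => j; rewrite !ffunE.
have mcell := measurable_voronoi_cell Q j.
rewrite voronoi_cell_torus_rotation circle_integralC_rotate //.
apply: carg_cexpiM.
have /andP[q0 _] := angle_range (Q j).
have [e e0 subcell] := voronoi_cell_right_nbhs Q j.
exact: (circle_integralC_arc_neq0 h_int h_gt0 mcell (hQ j) q0 e0 subcell).
Qed.
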